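(* Let $n$ be a positive integer and let $F_n=(f_{i,k})_{1\le i,k\le n}$ be the universal Costas frequency matrix of order $n$. Then $F_n$ has horizontal, vertical, and diagonal reflection symmetries, i.e., for all $i,k\in\{1,\dots,n\}$, $$f_{i,k}=f_{n+1-i,\,k}=f_{i,\,n+1-k}=f_{k,\,i}=f_{n+1-k,\,n+1-i}.$$ For odd $n$ the horizontal and vertical symmetry axes pass through the middle row and the middle column (index $(n+1)/2$, which is fixed by $i\mapsto n+1-i$), while for even $n$ they lie between the two middle rows and between the two middle columns (indices $n/2$ and $n/2+1$, which are exchanged by $i\mapsto n+1-i$).
   Context: A Costas array of order $n$ is an $n\times n$ permutation matrix such that the vectors connecting every two $1$'s are distinct. It is identified with the permutation $\pi$ of $\{1,\dots,n\}$ where $\pi(k)$ is the row index of the $1$ in column $k$; in these terms, the Costas condition is that the vectors $(j-i,\ \pi(j)-\pi(i))$, for $1\le i<j\le n$, are pairwise distinct. It is written as the row $(\pi(1),\dots,\pi(n))$. Let $C(n)$ be the number of distinct Costas arrays of order $n$. The universal Costas matrix (UCM) $U_n$ of order $n$ is the $C(n)\times n$ matrix whose rows are all the distinct Costas arrays of order $n$, each appearing exactly once, listed in canonical order (grouped into blocks by first element, with first elements in ascending order). The universal Costas frequency matrix (UCFM) $F_n$ of order $n$ is the $n\times n$ matrix whose entry $f_{i,k}$ is the number of times the integer $i$ occurs in the $k$-th column of $U_n$, i.e. $f_{i,k}=\#\{r : U_n(r,k)=i\}$. *)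

(* Defs.v *)
From mathcomp Require Import all_boot all_order all_fingroup all_algebra.

Set Implicit Arguments.
Unset Strict Implicit.
Unset Printing Implicit Defensive.

(* Rows, columns and symbols 1, ..., n are represented by 'I_n, hence shifted
   by one: the mathematical index i is the ordinal of value i - 1, and
   i |-> n + 1 - i becomes rev_ord. *)

(* The vector from the 1 in column p.1 to the 1 in column p.2, s k being the
   row of the 1 in column k. *)
Definition costas_vector (n : nat) (s : {perm 'I_n}) (p : 'I_n * 'I_n) :
    int * int :=
  ((p.2%:Z - p.1%:Z)%R, ((s p.2)%:Z - (s p.1)%:Z)%R).

Definition costas (n : nat) (s : {perm 'I_n}) : bool :=
  dinjectiveb (costas_vector s) [pred p : 'I_n * 'I_n | p.1 < p.2].

Definition costas_count (n : nat) : nat := #|[set s : {perm 'I_n} | costas s]|.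

Definition costas_row (n : nat) (s : {perm 'I_n}) : 'rV['I_n]_n :=
  (\row_k s k)%R.

(* The order of the rows inside a block with the same first element is left
   free, so a universal Costas matrix is a predicate rather than a function of
   n; ucm_exists shows that it is inhabited for every n. *)
Record is_ucm (n : nat) (U : 'M['I_n]_(costas_count n, n)) : Prop := IsUcm {
  ucm_row_costas : forall r, exists2 s : {perm 'I_n},
    costas s & row r U = costas_row s;
  ucm_row_once : forall s : {perm 'I_n}, costas s ->
    exists! r, row r U = costas_row s;
  ucm_row_order : forall (r r' : 'I_(costas_count n)) (k : 'I_n),
    k = 0 :> nat -> r <= r' -> U r k <= U r' k
}.

Definition ucfm (n : nat) (U : 'M['I_n]_(costas_count n, n)) : 'M[nat]_n :=
  (\matrix_(i, k) #|[set r | U r k == i]|%N)%R.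

Lemma costas_row_inj (n : nat) : injective (@costas_row n).
Proof.
by move=> s t /rowP st; apply/permP => k; have := st k; rewrite !mxE.
Qed.

Lemma ucm_exists (n : nat) : exists U : 'M['I_n]_(costas_count n, n), is_ucm U.
Proof.
pose le (s t : {perm 'I_n}) :=
  [forall k : 'I_n, (k == 0 :> nat) ==> (s k <= t k)].
have le_total : total le.
  move=> s t; case: (boolP (le s t)) => //= /forallPn [k].
  rewrite negb_imply -ltnNge => /andP[/eqP k0 ltk].
  apply/forallP => l; apply/implyP => /eqP l0.
  by have -> : l = k; [apply: val_inj; rewrite /= l0 k0 | apply: ltnW].
have le_trans : transitive le.
  move=> t s u /forallP st /forallP tu; apply/forallP => k; apply/implyP => k0.
  exact: leq_trans (implyP (st k) k0) (implyP (tu k) k0).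
pose L := sort le (enum [set s : {perm 'I_n} | costas s]).
have szL : size L = costas_count n by rewrite size_sort -cardE.
have memL s : (s \in L) = costas s by rewrite mem_sort mem_enum inE.
have uniqL : uniq L by rewrite sort_uniq enum_uniq.
pose U : 'M_(costas_count n, n) :=
  (\matrix_(r, k) nth 1%g L r k)%R.
have rowE r : row r U = costas_row (nth 1%g L r).
  by apply/rowP => k; rewrite !mxE.
exists U; split.
- by move=> r; exists (nth 1%g L r); rewrite ?rowE // -memL mem_nth // szL.
- move=> s; rewrite -memL => sL.
  have lt_s : index s L < costas_count n by rewrite -szL index_mem.
  exists (Ordinal lt_s); split; first by rewrite rowE nth_index.
  move=> r; rewrite rowE => /costas_row_inj rs; apply: val_inj => /=.
  by rewrite -rs index_uniq // szL.
- move=> r r' k k0 rr'; rewrite !mxE.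
  have le_refl : reflexive le by move=> s; have := le_total s s; rewrite orbb.
  have /forallP/(_ k)/implyP : le (nth 1%g L r) (nth 1%g L r').
    by apply: (sorted_leq_nth le_trans le_refl) => //;
      rewrite ?sort_sorted // inE szL.
  by apply; rewrite k0.
Qed.

(* Main.v *)
(* The reflections s |-> rev o s and s |-> s o rev and the transposition
   s |-> s^-1 are involutions of the set of Costas permutations, and
   f_(i, k) counts the Costas permutations that send k to i. *)
Require Import Defs.
From mathcomp Require Import all_boot all_order all_fingroup all_algebra.
From mathcomp Require Import zify.

(* Allowing i > j, and writing the equality of the vectors additively in nat,
   makes the condition visibly invariant under all three symmetries. *)
Lemma costasP (n : nat) (s : {perm 'I_n}) :
  reflect (forall i j k l : 'I_n, i != j ->
             j + k = l + i -> s j + s k = s l + s i -> i = k)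
          (costas s).
Proof.
apply: (iffP (dinjectiveP _ _)) => [inj i j k l | H].
  rewrite -val_eqE /= neq_ltn => /orP[ij | ji] ejk esjk.
    suff [] : (i, j) = (k, l) by [].
    apply: inj; rewrite ?inE /=; [by [] | lia |].
    by rewrite /costas_vector /=; congr pair; lia.
  (* When [j < i], the additive equations also force [l < k], so both vectors are read backwards to
     get increasing pairs. *)
  suff [] : (j, i) = (l, k) by [].
  apply: inj; rewrite ?inE /=; [by [] | lia |].
  by rewrite /costas_vector /=; congr pair; lia.
move=> [i j] [k l]; rewrite !inE /costas_vector /= => ij kl [ejk esjk].
have ik : i = k by apply: (H i j k l); rewrite -?val_eqE /=; lia.
by rewrite -ik in ejk *; congr pair; apply: val_inj => /=; lia.
Qed.

(** Substituting preimages under [s] in the additive criterion swaps the equation on columns with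
    the one on rows. *)
Lemma costasV (n : nat) (s : {perm 'I_n}) : costas s -> costas s^-1%g.
Proof.
move=> /costasP H; apply/costasP => i j k l ij ejk esjk.
apply: (@perm_inj _ s^-1%g).
by apply: (H _ (s^-1%g j) _ (s^-1%g l)); rewrite ?permKV // (inj_eq perm_inj).
Qed.

Definition rev_perm (n : nat) : {perm 'I_n} := perm (@rev_ord_inj n).

Lemma rev_permE (n : nat) (i : 'I_n) : rev_perm n i = rev_ord i.
Proof. exact: permE. Qed.

Lemma rev_permK (n : nat) : (rev_perm n * rev_perm n = 1)%g.
Proof. by apply/permP => i; rewrite permM !rev_permE rev_ordK perm1. Qed.

(** Products of permutations apply the left factor first, so this reverses rows; all row differences
    change sign, which preserves their equalities. *)
Lemma costas_mul_rev (n : nat) (s : {perm 'I_n}) :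
  costas s -> costas (s * rev_perm n)%g.
Proof.
move=> /costasP H; apply/costasP => i j k l ij ejk.
rewrite !permM !rev_permE /= => esjk; apply: (H i j k l) => //.
(* These bounds make the truncated subtractions in [rev_ord] exact. *)
have := (ltn_ord (s i), ltn_ord (s j), ltn_ord (s k), ltn_ord (s l)).
by move=> [[[]]]; lia.
Qed.

Lemma costas_rev_mul (n : nat) (s : {perm 'I_n}) :
  costas s -> costas (rev_perm n * s)%g.
Proof.
move=> /costasP H; apply/costasP => i j k l ij ejk.
rewrite !permM !rev_permE => esjk; apply: rev_ord_inj.
apply: (H _ (rev_ord j) _ (rev_ord l)) => //;
  first by rewrite (inj_eq rev_ord_inj).
by rewrite /=; have := (ltn_ord i, ltn_ord j, ltn_ord k, ltn_ord l) => -[[[]]]; lia.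
Qed.

(** Row indices and Costas permutations both embed into row vectors, and the two sets counted have
    the same image there. The order of the rows is thus irrelevant. *)
Lemma ucfmE (n : nat) (U : 'M['I_n]_(costas_count n, n)) (i k : 'I_n) :
  is_ucm U -> ucfm U i k = #|[set s : {perm 'I_n} | costas s & s k == i]|.
Proof.
case=> rowC row1 _; rewrite mxE.
have rowU_inj : injective (fun r => row r U).
  move=> r r' eq_r; have [s cs rs] := rowC r; have [t [_ tU]] := row1 s cs.
  by rewrite -(tU r rs) -(tU r') // -eq_r.
rewrite -(card_imset _ rowU_inj) -(card_imset _ (@costas_row_inj n)).
apply: eq_card => v; apply/imsetP/imsetP => -[].
  move=> r; rewrite inE => rk ->; have [s cs rs] := rowC r.
  exists s => //; rewrite inE cs /=.
  by have /rowP/(_ k) := rs; rewrite !mxE => <-.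
move=> s; rewrite inE => /andP[cs sk] ->; have [r [rs _]] := row1 s cs.
exists r => //; rewrite inE.
by have /rowP/(_ k) := rs; rewrite !mxE => ->.
Qed.

Lemma ucfm_sym (n : nat) (U : 'M['I_n]_(costas_count n, n))
    (g : {perm 'I_n} -> {perm 'I_n}) (i k i' k' : 'I_n) :
  is_ucm U -> involutive g -> (forall s, costas s -> costas (g s)) ->
  (forall s : {perm 'I_n}, (g s k' == i') = (s k == i)) ->
  ucfm U i k = ucfm U i' k'.
Proof.
move=> U_ucm gK g_costas g_ik; rewrite !ucfmE // -(card_imset _ (inv_inj gK)).
(* Writing [s] as [g (g s)] turns membership in the image into a condition on [g s]; involutivity
   also yields the converse of [g_costas]. *)
apply: eq_card => s; rewrite -{1}[s]gK mem_imset; last exact: inv_inj.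
rewrite !inE -g_ik gK; congr andb.
by apply/idP/idP => /g_costas; rewrite ?gK.
Qed.

Theorem theorem2 (n : nat) (n_gt0 : 0 < n)
    (U : 'M['I_n]_(costas_count n, n)) (U_ucm : is_ucm U) :
  [/\ forall i k : 'I_n,
        [/\ ucfm U i k = ucfm U (rev_ord i) k,
            ucfm U i k = ucfm U i (rev_ord k),
            ucfm U i k = ucfm U k i &
            ucfm U i k = ucfm U (rev_ord k) (rev_ord i)],
      odd n -> forall i : 'I_n,
        rev_ord i = i <-> i.+1 = (n + 1) %/ 2 &
      ~~ odd n ->
        (forall i : 'I_n, rev_ord i <> i) /\
        (forall i j : 'I_n, i.+1 = n %/ 2 -> j.+1 = n %/ 2 + 1 ->
           rev_ord i = j /\ rev_ord j = i)].
Proof.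
have rowS i k : ucfm U i k = ucfm U (rev_ord i) k.
  apply: (@ucfm_sym _ _ (fun s => s * rev_perm n)%g) => // [s | s | s].
  - by rewrite -mulgA rev_permK mulg1.
  - exact: costas_mul_rev.
  - by rewrite permM rev_permE (inj_eq rev_ord_inj).
have colS i k : ucfm U i k = ucfm U i (rev_ord k).
  apply: (@ucfm_sym _ _ (fun s => rev_perm n * s)%g) => // [s | s | s].
  - by rewrite mulgA rev_permK mul1g.
  - exact: costas_rev_mul.
  - by rewrite permM rev_permE rev_ordK.
have trS i k : ucfm U i k = ucfm U k i.
  apply: (@ucfm_sym _ _ (fun s => s^-1)%g) => // [s | s | s].
  - exact: invgK.
  - exact: costasV.
  - by rewrite -(inj_eq (@perm_inj _ s)) permKV eq_sym.
split=> [i k | n_odd i | n_even].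
(* The antidiagonal reflection is the transposition followed by both reversals. *)
- by split=> //; rewrite trS rowS colS.
- split=> [/(congr1 val) /= | e]; last apply: val_inj => /=;
    by have := ltn_ord i; lia.
(* With values starting at 0, a fixed point of [rev_ord] would give [n = 2 * i + 1], which is
   odd. *)
- split=> [i /(congr1 val) /= | i j ei ej]; first by have := ltn_ord i; lia.
  by split; apply: val_inj => /=; lia.
Qed.
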